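(* Let $\mathbb{X}$ be a tangent category. A pair of commuting vector fields in $\mathbb{X}$ is equivalent to a vector field in the tangent category $\mathsf{VF}(\mathbb{X})$: given an object $M$ and vector fields $V$ and $Y$ on $M$ in $\mathbb{X}$, $Y$ is a vector field on the object $(M,V)$ in $\mathsf{VF}(\mathbb{X})$ if and only if $V$ and $Y$ commute; and every vector field on $(M,V)$ in $\mathsf{VF}(\mathbb{X})$ is in particular a vector field on $M$ in $\mathbb{X}$.
   Context: Composition is written in diagrammatic order: $fg$ means first $f$, then $g$. A tangent category is a category $\mathbb{X}$ with a functor $T:\mathbb{X}\to\mathbb{X}$ and natural transformations $p:T\to 1$, $0:1\to T$, $+:T_2\to T$, $\ell:T\to T^2$, $c:T^2\to T^2$ such that: (1) for all $M,n$ the fibre power $T_nM$ of $n$ copies of $p_M:TM\to M$ exists and is preserved by every $T^k$; (2) $(p_M,+_M,0_M)$ is an additive bundle, i.e. a commutative monoid in $\mathbb{X}/M$; (3) $(\ell_M,0_M)$ is an additive bundle morphism (commuting square preserving addition and zero) from $(p_M,+_M,0_M)$ to $(T(p_M),T(+_M),T(0_M))$, and $(c_M,1_{TM})$ is one from $(T(p_M),T(+_M),T(0_M))$ to $(p_{TM},+_{TM},0_{TM})$; (4) $cc=1$, $\ell c=\ell$, $\ell T(\ell)=\ell\ell_T$, $T(c)c_TT(c)=c_TT(c)c_T$, $\ell_TT(c)c_T=cT(\ell)$; (5) with $v:=\langle\pi_0\ell,\pi_10_{TM}\rangle T(+):T_2M\to T^2M$, the square $vT(p)=\pi_0p0$ exhibits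 $T_2M$ as the pullback of $T(p_M)$ along $0_M$, and this pullback is preserved by every $T^k$. A vector field on $M$ is a map $V:M\to TM$ with $Vp=1_M$. A vector field morphism $f:(M_1,V_1)\to(M_2,V_2)$ is a map $f:M_1\to M_2$ with $V_1T(f)=fV_2$. $\mathsf{VF}(\mathbb{X})$ is the tangent category whose objects are pairs $(M,V)$ with $V$ a vector field on $M$, whose maps are vector field morphisms, with tangent functor $\bar T(M,V)=(TM,T(V)c)$, $\bar T(f)=T(f)$, and structural transformations as in $\mathbb{X}$. Vector fields $V_1,V_2$ on $M$ commute if $V_1T(V_2)c=V_2T(V_1)$; this relation is symmetric. *)

(* Defs.v *)
From mathcomp Require Import all_boot.
From mathcomp Require Import boolp.

Set Implicit Arguments.
Unset Strict Implicit.
Unset Printing Implicit Defensive.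

Reserved Notation "A ~> B" (at level 70, no associativity).
Reserved Notation "f ;; g" (at level 45, left associativity).

(* Composition is diagrammatic: [f ;; g] is first [f], then [g]. *)
Record category := Category {
  obj :> Type;
  hom : obj -> obj -> Type;
  idm : forall A, hom A A;
  seqm : forall A B C, hom A B -> hom B C -> hom A C;
  seq1m : forall A B (f : hom A B), seqm (idm A) f = f;
  seqm1 : forall A B (f : hom A B), seqm f (idm B) = f;
  seqmA : forall A B C D (f : hom A B) (g : hom B C) (h : hom C D),
    seqm f (seqm g h) = seqm (seqm f g) h }.
Arguments idm {c} A.

Notation "A ~> B" := (hom A B).
Notation "f ;; g" := (seqm f g).

Record functor (C D : category) := Functor {
  fobj :> C -> D;
  fmap : forall A B, (A ~> B) -> (fobj A ~> fobj B);
  fmap1 : forall A, fmap (idm A) = idm (fobj A);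
  fmapM : forall A B E (f : A ~> B) (g : B ~> E),
    fmap (f ;; g) = fmap f ;; fmap g }.
Arguments fmap {C D} f0 {A B} f.

Definition functor_id (C : category) : functor C C :=
  @Functor C C (fun A => A) (fun A B f => f) (fun A => erefl)
    (fun A B E f g => erefl).

(* The composite which applies [F] first. *)
Section FunctorComp.
Variables (C D E : category) (F : functor C D) (G : functor D E).

Lemma functor_comp1 A : fmap G (fmap F (idm A)) = idm (G (F A)).
Proof. by rewrite !fmap1. Qed.

Lemma functor_compM A B K (f : A ~> B) (g : B ~> K) :
  fmap G (fmap F (f ;; g)) = fmap G (fmap F f) ;; fmap G (fmap F g).
Proof. by rewrite !fmapM. Qed.

Definition functor_comp : functor C E :=
  @Functor C E (fun A => G (F A)) (fun A B f => fmap G (fmap F f))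
    functor_comp1 functor_compM.
End FunctorComp.

Fixpoint functor_pow (C : category) (F : functor C C) (k : nat) :
    functor C C :=
  if k is k'.+1 then functor_comp F (functor_pow F k') else functor_id C.

Record nattrans (C D : category) (F G : functor C D) := NatTrans {
  ntc :> forall A, F A ~> G A;
  ntN : forall A B (f : A ~> B), fmap F f ;; ntc B = ntc A ;; fmap G f }.

Definition is_pullback (C : category) (P A B S : C) (a : P ~> A) (b : P ~> B)
    (f : A ~> S) (g : B ~> S) : Prop :=
  a ;; f = b ;; g /\
  forall (X : C) (x : X ~> A) (y : X ~> B), x ;; f = y ;; g ->
    exists! h : X ~> P, h ;; a = x /\ h ;; b = y.

Section FibrePower.
Variable C : category.

(* [P], with projections [pr i] to [E] and leg [b] to [M], is the product of
   [n] copies of [q] in the slice over [M]; for [n = 0] it is [M] itself. *)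
Definition is_fibre_power (n : nat) (P E M : C) (q : E ~> M)
    (pr : 'I_n -> (P ~> E)) (b : P ~> M) : Prop :=
  (forall i, pr i ;; q = b) /\
  forall (X : C) (x : 'I_n -> (X ~> E)) (y : X ~> M),
    (forall i, x i ;; q = y) ->
    exists! h : X ~> P, (forall i, h ;; pr i = x i) /\ h ;; b = y.

Record fibre_power (n : nat) (E M : C) (q : E ~> M) := FibrePower {
  fp_obj :> C;
  fp_pr : 'I_n -> (fp_obj ~> E);
  fp_leg : fp_obj ~> M;
  fp_ok : is_fibre_power q fp_pr fp_leg }.

Section Theory.
Variables (n : nat) (E M : C) (q : E ~> M) (P : fibre_power n q).

Lemma fp_over i : fp_pr P i ;; q = fp_leg P.
Proof. by case: (fp_ok P) => H _; apply: H. Qed.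

Definition fp_lift_subproof (X : C) (x : 'I_n -> (X ~> E)) (y : X ~> M)
    (H : forall i, x i ;; q = y) :=
  cid ((fp_ok P).2 X x y H).

Definition fp_lift (X : C) (x : 'I_n -> (X ~> E)) (y : X ~> M)
    (H : forall i, x i ;; q = y) : X ~> P :=
  sval (fp_lift_subproof H).

Lemma fp_lift_pr X (x : 'I_n -> (X ~> E)) y (H : forall i, x i ;; q = y) i :
  fp_lift H ;; fp_pr P i = x i.
Proof. by rewrite /fp_lift; case: fp_lift_subproof => h [[h1 h2] _] /=. Qed.

Lemma fp_lift_leg X (x : 'I_n -> (X ~> E)) y (H : forall i, x i ;; q = y) :
  fp_lift H ;; fp_leg P = y.
Proof. by rewrite /fp_lift; case: fp_lift_subproof => h [[h1 h2] _] /=. Qed.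

Lemma fp_ext X (h k : X ~> P) :
  (forall i, h ;; fp_pr P i = k ;; fp_pr P i) ->
  h ;; fp_leg P = k ;; fp_leg P -> h = k.
Proof.
move=> e1 e2.
have H i : (k ;; fp_pr P i) ;; q = k ;; fp_leg P by rewrite -seqmA fp_over.
have [m [_ U]] := (fp_ok P).2 X _ _ H.
by rewrite -(U h (conj e1 e2)); apply: U.
Qed.

End Theory.

Section Pairing.
Variables (E M : C) (q : E ~> M) (P : fibre_power 2 q).

Definition pr0 : P ~> E := fp_pr P ord0.
Definition pr1 : P ~> E := fp_pr P ord_max.

Lemma pair_over X (x y : X ~> E) (H : x ;; q = y ;; q) (i : 'I_2) :
  tnth [tuple x; y] i ;; q = y ;; q.
Proof. by case: i => [[|[|//]] ?]; rewrite /tnth. Qed.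

Definition pair X (x y : X ~> E) (H : x ;; q = y ;; q) : X ~> P :=
  fp_lift P (pair_over H).

Lemma pr0_pr1 : pr0 ;; q = pr1 ;; q.
Proof. by rewrite !fp_over. Qed.

Lemma pair_pr0 X (x y : X ~> E) (H : x ;; q = y ;; q) : pair H ;; pr0 = x.
Proof. exact: fp_lift_pr. Qed.

Lemma pair_pr1 X (x y : X ~> E) (H : x ;; q = y ;; q) : pair H ;; pr1 = y.
Proof. exact: fp_lift_pr. Qed.

Lemma pair_ext X (h k : X ~> P) :
  h ;; pr0 = k ;; pr0 -> h ;; pr1 = k ;; pr1 -> h = k.
Proof.
move=> e0 e1; apply: fp_ext => [i|].
  case: i => [[|[|//]] lti].
    by rewrite (_ : Ordinal lti = ord0) //; apply: val_inj.
  by rewrite (_ : Ordinal lti = ord_max) //; apply: val_inj.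
by rewrite -(fp_over P ord0) !seqmA -/pr0 e0.
Qed.

Lemma pair_uniq X (x y : X ~> E) (H : x ;; q = y ;; q) h :
  h ;; pr0 = x -> h ;; pr1 = y -> h = pair H.
Proof. by move=> e0 e1; apply: pair_ext; rewrite ?pair_pr0 ?pair_pr1. Qed.

End Pairing.

(* A commutative monoid in the slice over [M]: [P2] and [P3] are the square
   and the cube of [q] there.  The pairings below take a proof that their
   components agree over [M]; such proofs always exist, and the laws quantify
   over them rather than exhibit them. *)
Record additive_bundle (E M : C) (q : E ~> M) (P2 : fibre_power 2 q)
    (P3 : fibre_power 3 q) (add : P2 ~> E) (zero : M ~> E) : Prop :=
  AdditiveBundle {
  ab_add_over : add ;; q = fp_leg P2;
  ab_zero_over : zero ;; q = idm M;
  ab_comm : forall H : pr1 P2 ;; q = pr0 P2 ;; q, pair P2 H ;; add = add;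
  ab_unit : forall H : idm E ;; q = (q ;; zero) ;; q,
    pair P2 H ;; add = idm E;
  ab_assoc :
    let x := fp_pr P3 ord0 in
    let y := fp_pr P3 (@Ordinal 3 1 isT) in
    let z := fp_pr P3 ord_max in
    forall (Hxy : x ;; q = y ;; q) (Hyz : y ;; q = z ;; q)
      (Hxy_z : (pair P2 Hxy ;; add) ;; q = z ;; q)
      (Hx_yz : x ;; q = (pair P2 Hyz ;; add) ;; q),
    pair P2 Hxy_z ;; add = pair P2 Hx_yz ;; add }.

Record additive_bundle_morphism
    (E M : C) (q : E ~> M) (P2 : fibre_power 2 q)
    (add : P2 ~> E) (zero : M ~> E)
    (E' M' : C) (q' : E' ~> M') (P2' : fibre_power 2 q')
    (add' : P2' ~> E') (zero' : M' ~> E')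
    (f : E ~> E') (g : M ~> M') : Prop := AdditiveBundleMorphism {
  abm_square : f ;; q' = q ;; g;
  abm_add : forall H : (pr0 P2 ;; f) ;; q' = (pr1 P2 ;; f) ;; q',
    add ;; f = pair P2' H ;; add';
  abm_zero : zero ;; f = g ;; zero' }.

End FibrePower.

(* A functor [T] with a projection [p] and chosen fibre powers [T_n M] of
   [p_M], preserved by every iterate of [T]. *)
Record pretangent (X : category) := PreTangent {
  ptT : functor X X;
  ptp : nattrans ptT (functor_id X);
  ptTn : forall (n : nat) (M : X), fibre_power n (ptp M);
  ptTn_pres : forall (n : nat) (M : X) (k : nat),
    is_fibre_power (fmap (functor_pow ptT k) (ptp M))
      (fun i => fmap (functor_pow ptT k) (fp_pr (ptTn n M) i))
      (fmap (functor_pow ptT k) (fp_leg (ptTn n M))) }.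

Section PreTangentTheory.
Variables (X : category) (S : pretangent X).
Local Notation T := (ptT S).
Local Notation p := (ptp S).

Definition ptTTn n (M : X) : fibre_power n (fmap T (p M)) :=
  FibrePower (ptTn_pres S n M 1).

Section Map.
Variables (n : nat) (M N : X) (f : M ~> N).

Lemma ptTn_map_over i :
  (fp_pr (ptTn S n M) i ;; fmap T f) ;; p N = fp_leg (ptTn S n M) ;; f.
Proof. by rewrite -seqmA ntN seqmA fp_over. Qed.

Definition ptTn_map : ptTn S n M ~> ptTn S n N :=
  fp_lift (ptTn S n N) ptTn_map_over.
End Map.

Lemma ptTn_map1 n M : ptTn_map n (idm M) = idm (ptTn S n M : X).
Proof.
apply: fp_ext => [i|].
  by rewrite fp_lift_pr fmap1 seqm1 seq1m.
by rewrite fp_lift_leg seqm1 seq1m.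
Qed.

Lemma ptTn_mapM n A B K (f : A ~> B) (g : B ~> K) :
  ptTn_map n (f ;; g) = ptTn_map n f ;; ptTn_map n g.
Proof.
apply: fp_ext => [i|].
  by rewrite -seqmA !fp_lift_pr fmapM !seqmA !fp_lift_pr.
by rewrite -seqmA !fp_lift_leg !seqmA !fp_lift_leg.
Qed.

Definition ptTn_functor n : functor X X :=
  @Functor X X (fun M => ptTn S n M) (@ptTn_map n) (@ptTn_map1 n)
    (@ptTn_mapM n).

End PreTangentTheory.

Record tangent_data (X : category) := TangentData {
  tdS :> pretangent X;
  td0 : nattrans (functor_id X) (ptT tdS);
  tdadd : nattrans (ptTn_functor tdS 2) (ptT tdS);
  tdl : nattrans (ptT tdS) (functor_comp (ptT tdS) (ptT tdS));
  tdc : nattrans (functor_comp (ptT tdS) (ptT tdS))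
                 (functor_comp (ptT tdS) (ptT tdS)) }.

Section TangentAxioms.
Variables (X : category) (S : tangent_data X).
Local Notation T := (ptT S).
Local Notation p := (ptp S).
Local Notation z := (td0 S).
Local Notation add := (tdadd S).
Local Notation l := (tdl S).
Local Notation c := (tdc S).

(* The map [v := <pi_0 l, pi_1 0_{TM}> T(+)]. *)
Definition vlift (M : X)
    (H : (pr0 (ptTn S 2 M) ;; l M) ;; fmap T (p M)
       = (pr1 (ptTn S 2 M) ;; z (T M)) ;; fmap T (p M)) :
    ptTn S 2 M ~> T (T M) :=
  pair (ptTTn S 2 M) H ;; fmap T (add M).

Record tangent_axioms : Prop := TangentAxioms {
  ta_add : forall M : X,
    additive_bundle (ptTn S 3 M) (add M) (z M);
  ta_l : forall M : X,
    additive_bundle_morphism (add M) (z M)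
      (P2' := ptTTn S 2 M) (fmap T (add M)) (fmap T (z M))
      (l M) (z M);
  ta_c : forall M : X,
    additive_bundle_morphism
      (P2 := ptTTn S 2 M) (fmap T (add M)) (fmap T (z M))
      (add (T M)) (z (T M))
      (c M) (idm (T M));
  ta_cc : forall M : X, c M ;; c M = idm (T (T M));
  ta_lc : forall M : X, l M ;; c M = l M;
  ta_ll : forall M : X, l M ;; fmap T (l M) = l M ;; l (T M);
  ta_ccc : forall M : X,
    fmap T (c M) ;; c (T M) ;; fmap T (c M)
    = c (T M) ;; fmap T (c M) ;; c (T M);
  ta_lcc : forall M : X,
    l (T M) ;; fmap T (c M) ;; c (T M) = c M ;; fmap T (l M);
  ta_vlift : forall (M : X) H (k : nat),
    is_pullback (fmap (functor_pow T k) (@vlift M H))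
      (fmap (functor_pow T k) (pr0 (ptTn S 2 M) ;; p M))
      (fmap (functor_pow T k) (fmap T (p M)))
      (fmap (functor_pow T k) (z M)) }.

End TangentAxioms.

Record tangent_category := TangentCategory {
  tc_cat :> category;
  tc_data : tangent_data tc_cat;
  tc_axioms : tangent_axioms tc_data }.

Notation tcT X := (ptT (tdS (tc_data X))).
Notation tcp X := (ptp (tdS (tc_data X))).
Notation tcc X := (tdc (tc_data X)).

Definition is_vector_field (X : tangent_category) (M : X) (V : M ~> tcT X M) :
    Prop :=
  V ;; tcp X M = idm M.

Definition vf_commute (X : tangent_category) (M : X) (V1 V2 : M ~> tcT X M) :
    Prop :=
  V1 ;; fmap (tcT X) V2 ;; tcc X M = V2 ;; fmap (tcT X) V1.

Section VF.
Variable X : tangent_category.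
Local Notation S := (tc_data X).
Local Notation T := (ptT (tc_data X)).
Local Notation p := (ptp (tc_data X)).
Local Notation z := (td0 (tc_data X)).
Local Notation add := (tdadd (tc_data X)).
Local Notation l := (tdl (tc_data X)).
Local Notation c := (tdc (tc_data X)).

Record vf_obj := VFObj {
  vf_car : X;
  vf_fld : vf_car ~> tcT X vf_car;
  vf_ok : is_vector_field vf_fld }.

Record vf_hom (A B : vf_obj) := VFHom {
  vf_map : vf_car A ~> vf_car B;
  vf_mapP : vf_fld A ;; fmap (tcT X) vf_map = vf_map ;; vf_fld B }.

Lemma vf_hom_eq A B (f g : vf_hom A B) : vf_map f = vf_map g -> f = g.
Proof.
case: f g => f fP [g gP] /= e; rewrite -{g}e in gP *.
by rewrite (Prop_irrelevance fP gP).
Qed.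

Lemma vf_idP (A : vf_obj) :
  vf_fld A ;; fmap T (idm (vf_car A)) = idm (vf_car A) ;; vf_fld A.
Proof. by rewrite fmap1 seqm1 seq1m. Qed.

Lemma vf_seqP (A B D : vf_obj) (f : vf_hom A B) (g : vf_hom B D) :
  vf_fld A ;; fmap T (vf_map f ;; vf_map g) = vf_map f ;; vf_map g ;; vf_fld D.
Proof. by rewrite fmapM seqmA vf_mapP -seqmA vf_mapP seqmA. Qed.

Definition vf_id A : vf_hom A A := VFHom (vf_idP A).
Definition vf_seq A B D (f : vf_hom A B) (g : vf_hom B D) : vf_hom A D :=
  VFHom (vf_seqP f g).

Lemma vf_seq1m A B (f : vf_hom A B) : vf_seq (vf_id A) f = f.
Proof. by apply: vf_hom_eq; apply: seq1m. Qed.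
Lemma vf_seqm1 A B (f : vf_hom A B) : vf_seq f (vf_id B) = f.
Proof. by apply: vf_hom_eq; apply: seqm1. Qed.
Lemma vf_seqmA A B D E (f : vf_hom A B) (g : vf_hom B D) (h : vf_hom D E) :
  vf_seq f (vf_seq g h) = vf_seq (vf_seq f g) h.
Proof. by apply: vf_hom_eq; apply: seqmA. Qed.

Definition VF_cat : category := Category vf_seq1m vf_seqm1 vf_seqmA.

Definition VF_forget : functor VF_cat X :=
  @Functor VF_cat X vf_car vf_map (fun A => erefl) (fun A B D f g => erefl).
Local Notation U := VF_forget.

Lemma U_inj (A B : VF_cat) (f g : A ~> B) : fmap U f = fmap U g -> f = g.
Proof. exact: vf_hom_eq. Qed.

Lemma c_p M : c M ;; p (T M) = fmap T (p M).
Proof. by rewrite (abm_square (ta_c (tc_axioms X) M)) seqm1. Qed.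

Lemma c_Tp M : c M ;; fmap T (p M) = p (T M).
Proof. by rewrite -c_p seqmA (ta_cc (tc_axioms X)) seq1m. Qed.

Lemma vf_T_ok (A : vf_obj) : (fmap T (vf_fld A) ;; c (vf_car A)) ;;
  p (T (vf_car A)) = idm (T (vf_car A)).
Proof. by rewrite -seqmA c_p -fmapM (vf_ok A) fmap1. Qed.

Definition vf_T (A : VF_cat) : VF_cat :=
  @VFObj (T (vf_car A)) (fmap T (vf_fld A) ;; c (vf_car A)) (vf_T_ok A).

Lemma c_nat M N (f : M ~> N) :
  fmap T (fmap T f) ;; c N = c M ;; fmap T (fmap T f).
Proof. exact: (ntN c f). Qed.
Lemma l_nat M N (f : M ~> N) :
  fmap T f ;; l N = l M ;; fmap T (fmap T f).
Proof. exact: (ntN l f). Qed.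
Lemma z_nat M N (f : M ~> N) : f ;; z N = z M ;; fmap T f.
Proof. exact: (ntN z f). Qed.
Lemma p_nat M N (f : M ~> N) : fmap T f ;; p N = p M ;; f.
Proof. exact: (ntN p f). Qed.

Lemma vf_TmapP (A B : VF_cat) (f : A ~> B) :
  vf_fld (vf_T A) ;; fmap T (fmap T (vf_map f))
  = fmap T (vf_map f) ;; vf_fld (vf_T B).
Proof. by rewrite /= -seqmA -c_nat !seqmA -!fmapM (vf_mapP f). Qed.

Definition vf_Tmap (A B : VF_cat) (f : A ~> B) : vf_T A ~> vf_T B :=
  @VFHom (vf_T A) (vf_T B) (fmap T (vf_map f)) (vf_TmapP f).

Lemma vf_Tmap1 (A : VF_cat) : vf_Tmap (idm A) = idm (vf_T A).
Proof. by apply: U_inj; exact: (fmap1 T _). Qed.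

Lemma vf_TmapM (A B D : VF_cat) (f : A ~> B) (g : B ~> D) :
  vf_Tmap (f ;; g) = vf_Tmap f ;; vf_Tmap g.
Proof. by apply: U_inj; exact: (fmapM T _ _). Qed.

Definition VF_T : functor VF_cat VF_cat := Functor vf_Tmap1 vf_TmapM.

Lemma vf_pP (A : VF_cat) :
  vf_fld (vf_T A) ;; fmap T (p (vf_car A)) = p (vf_car A) ;; vf_fld A.
Proof. by rewrite /= -seqmA c_Tp p_nat. Qed.

Definition vf_p (A : VF_cat) : VF_T A ~> A :=
  @VFHom (VF_T A) A (p (vf_car A)) (vf_pP A).

Lemma vf_pN (A B : VF_cat) (f : A ~> B) :
  fmap VF_T f ;; vf_p B = vf_p A ;; f.
Proof. by apply: U_inj; apply: p_nat. Qed.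

Definition VF_p : nattrans VF_T (functor_id VF_cat) :=
  @NatTrans VF_cat VF_cat VF_T (functor_id VF_cat) vf_p vf_pN.

(* A cone in VF(X) is limiting as soon as its images under [U] and under
   [U] followed by [T] are limiting in X. *)

Lemma VF_fibre_power0 n (P E M : VF_cat) (q : E ~> M)
    (pr : 'I_n -> (P ~> E)) (b : P ~> M) :
  is_fibre_power (fmap U q) (fun i => fmap U (pr i)) (fmap U b) ->
  is_fibre_power (fmap T (fmap U q)) (fun i => fmap T (fmap U (pr i)))
    (fmap T (fmap U b)) ->
  is_fibre_power q pr b.
Proof.
move=> H0 H1; split=> [i|A x y xy].
  by apply: U_inj; case: H0 => H0 _; apply: H0.
pose P0 := FibrePower H0; pose P1 := FibrePower H1.
have xyU i : fmap U (x i) ;; fmap U q = fmap U y by rewrite -(xy i).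
pose h := fp_lift P0 xyU.
have hpr i : h ;; fmap U (pr i) = fmap U (x i) := fp_lift_pr P0 xyU i.
have hb : h ;; fmap U b = fmap U y := fp_lift_leg P0 xyU.
have hP : vf_fld A ;; fmap T h = h ;; vf_fld P.
  apply: (fp_ext (P := P1)) => [i|] /=.
    rewrite -!seqmA -fmapM hpr -[RHS]/(h ;; (vf_fld P ;; fmap (tcT X) _)).
    by rewrite (vf_mapP (pr i)) seqmA hpr -(vf_mapP (x i)).
  rewrite -!seqmA -fmapM hb -[RHS]/(h ;; (vf_fld P ;; fmap (tcT X) _)).
  by rewrite (vf_mapP b) seqmA hb -(vf_mapP y).
exists (@VFHom A P h hP); split.
  by split=> [i|]; apply: U_inj; [apply: hpr | apply: hb].
move=> k [kpr kb]; apply: U_inj; apply: (fp_ext (P := P0)) => [i|].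
  by rewrite [LHS]hpr -(kpr i).
by rewrite [LHS]hb -kb.
Qed.

Lemma VF_fibre_power n (P E M : VF_cat) (q : E ~> M)
    (pr : 'I_n -> (P ~> E)) (b : P ~> M) :
  (forall k, is_fibre_power (fmap (functor_pow T k) (fmap U q))
     (fun i => fmap (functor_pow T k) (fmap U (pr i)))
     (fmap (functor_pow T k) (fmap U b))) ->
  forall k, is_fibre_power (fmap (functor_pow VF_T k) q)
     (fun i => fmap (functor_pow VF_T k) (pr i))
     (fmap (functor_pow VF_T k) b).
Proof.
move=> H k; elim: k P E M q pr b H => [|k IH] P E M q pr b H.
  by apply: VF_fibre_power0; [apply: (H 0) | apply: (H 1)].
by apply: (IH _ _ _ (fmap VF_T q) (fun i => fmap VF_T (pr i)) (fmap VF_T b))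
  => j; apply: (H j.+1).
Qed.

Lemma pullback_ext (C : category) (P A B D : C) (a : P ~> A) (b : P ~> B)
    (f : A ~> D) (g : B ~> D) (Y : C) (h k : Y ~> P) :
  is_pullback a b f g -> h ;; a = k ;; a -> h ;; b = k ;; b -> h = k.
Proof.
case=> e H ea eb.
have e' : (k ;; a) ;; f = (k ;; b) ;; g by rewrite -!seqmA e.
have [m [_ um]] := H _ _ _ e'.
by rewrite -(um h (conj ea eb)); apply: um.
Qed.

Lemma VF_pullback0 (P A B D : VF_cat) (a : P ~> A) (b : P ~> B)
    (f : A ~> D) (g : B ~> D) :
  is_pullback (fmap U a) (fmap U b) (fmap U f) (fmap U g) ->
  is_pullback (fmap T (fmap U a)) (fmap T (fmap U b))
    (fmap T (fmap U f)) (fmap T (fmap U g)) ->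
  is_pullback a b f g.
Proof.
move=> H0 H1; split; first by apply: U_inj; case: H0.
move=> Y x y xy.
have xyU : fmap U x ;; fmap U f = fmap U y ;; fmap U g.
  exact: (congr1 (fmap U) xy).
have [h [[ha hb] _]] := H0.2 _ _ _ xyU.
have hP : vf_fld Y ;; fmap T h = h ;; vf_fld P.
  apply: (pullback_ext H1).
    rewrite -!seqmA -fmapM ha -[RHS]/(h ;; (vf_fld P ;; fmap (tcT X) _)).
    by rewrite (vf_mapP a) seqmA ha -(vf_mapP x).
  rewrite -!seqmA -fmapM hb -[RHS]/(h ;; (vf_fld P ;; fmap (tcT X) _)).
  by rewrite (vf_mapP b) seqmA hb -(vf_mapP y).
exists (@VFHom Y P h hP); split.
  by split; apply: U_inj; [apply: ha | apply: hb].
move=> k [ka kb]; apply: U_inj; apply: (pullback_ext H0).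
  by rewrite [LHS]ha -ka.
by rewrite [LHS]hb -kb.
Qed.

Lemma VF_pullback (P A B D : VF_cat) (a : P ~> A) (b : P ~> B)
    (f : A ~> D) (g : B ~> D) :
  (forall k, is_pullback
     (fmap (functor_pow T k) (fmap U a)) (fmap (functor_pow T k) (fmap U b))
     (fmap (functor_pow T k) (fmap U f)) (fmap (functor_pow T k) (fmap U g))) ->
  forall k, is_pullback
     (fmap (functor_pow VF_T k) a) (fmap (functor_pow VF_T k) b)
     (fmap (functor_pow VF_T k) f) (fmap (functor_pow VF_T k) g).
Proof.
move=> H k; elim: k P A B D a b f g H => [|k IH] P A B D a b f g H.
  by apply: VF_pullback0; [apply: (H 0) | apply: (H 1)].
by apply: (IH _ _ _ _ (fmap VF_T a) (fmap VF_T b) (fmap VF_T f) (fmap VF_T g))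
  => j; apply: (H j.+1).
Qed.

(* The fibre powers: [T_n (M, V)] is [T_n M] with the induced vector field. *)

Section Tn.
Variables (n : nat) (A : VF_cat).
Let M := vf_car A.
Let P := ptTn S n M.

Lemma vf_Tn_over i :
  (fp_pr P i ;; (fmap T (vf_fld A) ;; c M)) ;; fmap T (p M)
  = fp_leg P ;; vf_fld A.
Proof. by rewrite -!seqmA c_Tp p_nat seqmA fp_over. Qed.

Definition vf_Tn_fld : P ~> T P := fp_lift (ptTTn S n M) vf_Tn_over.

Lemma vf_Tn_fld_pr i : vf_Tn_fld ;; fmap T (fp_pr P i)
  = fp_pr P i ;; (fmap T (vf_fld A) ;; c M).
Proof. exact: (fp_lift_pr (ptTTn S n M) vf_Tn_over). Qed.

Lemma vf_Tn_fld_leg : vf_Tn_fld ;; fmap T (fp_leg P) = fp_leg P ;; vf_fld A.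
Proof. exact: (fp_lift_leg (ptTTn S n M) vf_Tn_over). Qed.

Lemma vf_Tn_ok : vf_Tn_fld ;; p P = idm (P : X).
Proof.
apply: fp_ext => [i|].
  by rewrite -seqmA -p_nat seqmA vf_Tn_fld_pr -seqmA (vf_T_ok A) seqm1 seq1m.
by rewrite -seqmA -p_nat seqmA vf_Tn_fld_leg -seqmA (vf_ok A) seqm1 seq1m.
Qed.

Definition vf_Tn : VF_cat := @VFObj P vf_Tn_fld vf_Tn_ok.
Definition vf_Tn_pr (i : 'I_n) : vf_Tn ~> VF_T A :=
  @VFHom vf_Tn (VF_T A) (fp_pr P i) (vf_Tn_fld_pr i).
Definition vf_Tn_leg : vf_Tn ~> A := @VFHom vf_Tn A (fp_leg P) vf_Tn_fld_leg.

Lemma vf_Tn_pres (k : nat) :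
  is_fibre_power (fmap (functor_pow VF_T k) (VF_p A))
    (fun i => fmap (functor_pow VF_T k) (vf_Tn_pr i))
    (fmap (functor_pow VF_T k) vf_Tn_leg).
Proof. by apply: VF_fibre_power => j; apply: (ptTn_pres S n M j). Qed.

Definition VF_Tn : fibre_power n (VF_p A) := FibrePower (vf_Tn_pres 0).

End Tn.

Definition VF_pretangent : pretangent VF_cat :=
  @PreTangent VF_cat VF_T VF_p VF_Tn vf_Tn_pres.

Lemma vf_zP (A : VF_cat) :
  vf_fld A ;; fmap T (z (vf_car A)) = z (vf_car A) ;; vf_fld (VF_T A).
Proof.
have Tz_c : fmap T (z (vf_car A)) ;; c (vf_car A) = z (T (vf_car A)).
  by rewrite (abm_zero (ta_c (tc_axioms X) _)) seq1m.
by rewrite /= seqmA -z_nat -seqmA -Tz_c -(seqmA _ (c _)) (ta_cc (tc_axioms X))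
  seqm1.
Qed.

Definition vf_z (A : VF_cat) : A ~> VF_T A :=
  @VFHom A (VF_T A) (z (vf_car A)) (vf_zP A).

Lemma vf_zN (A B : VF_cat) (f : A ~> B) : f ;; vf_z B = vf_z A ;; fmap VF_T f.
Proof. by apply: U_inj; apply: z_nat. Qed.

Definition VF_0 : nattrans (functor_id VF_cat) VF_T :=
  @NatTrans VF_cat VF_cat (functor_id VF_cat) VF_T vf_z vf_zN.

Lemma vf_addP (A : VF_cat) :
  vf_fld (vf_Tn 2 A) ;; fmap T (add (vf_car A))
  = add (vf_car A) ;; vf_fld (VF_T A).
Proof.
set M := vf_car A; rewrite /= -/M.
have HT := pr0_pr1 (ptTTn S 2 M).
have Hc : (pr0 (ptTTn S 2 M) ;; c M) ;; p (T M)
        = (pr1 (ptTTn S 2 M) ;; c M) ;; p (T M) by rewrite -!seqmA !c_p.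
have E := abm_add (ta_c (tc_axioms X) M) Hc.
have E2 : fmap T (add M) = pair (ptTn S 2 (T M)) Hc ;; add (T M) ;; c M.
  by rewrite -E -seqmA (ta_cc (tc_axioms X)) seqm1.
have N : ptTn_map S 2 (vf_fld A) ;; add (T M) = add M ;; fmap T (vf_fld A).
  exact: (ntN add (vf_fld A)).
rewrite E2 !seqmA -N; do 2 congr (_ ;; _).
have e i : vf_Tn_fld 2 A ;; fmap T (fp_pr (ptTn S 2 M) i) ;; c M
   = fp_pr (ptTn S 2 M) i ;; fmap T (vf_fld A).
  by rewrite vf_Tn_fld_pr -!seqmA (ta_cc (tc_axioms X)) seqm1.
apply: pair_ext.
  by rewrite -seqmA pair_pr0 seqmA [LHS]e [RHS]fp_lift_pr.
by rewrite -seqmA pair_pr1 seqmA [LHS]e [RHS]fp_lift_pr.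
Qed.

Definition vf_add (A : VF_cat) : vf_Tn 2 A ~> VF_T A :=
  @VFHom (vf_Tn 2 A) (VF_T A) (add (vf_car A)) (vf_addP A).

Lemma U_Tn_map n (A B : VF_cat) (f : A ~> B) :
  fmap U (ptTn_map VF_pretangent n f) = ptTn_map S n (fmap U f).
Proof.
apply: fp_ext => [i|].
  rewrite [RHS]fp_lift_pr.
  exact: (congr1 (fmap U)
    (fp_lift_pr (VF_Tn n B) (@ptTn_map_over _ VF_pretangent n A B f) i)).
rewrite [RHS]fp_lift_leg.
exact: (congr1 (fmap U)
  (fp_lift_leg (VF_Tn n B) (@ptTn_map_over _ VF_pretangent n A B f))).
Qed.

Lemma vf_addN (A B : VF_cat) (f : A ~> B) :
  fmap (ptTn_functor VF_pretangent 2) f ;; vf_add B = vf_add A ;; fmap VF_T f.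
Proof.
apply: U_inj; rewrite fmapM [fmap U (fmap _ f)]U_Tn_map.
exact: (ntN add (fmap U f)).
Qed.

Definition VF_add : nattrans (ptTn_functor VF_pretangent 2) VF_T :=
  @NatTrans _ _ (ptTn_functor VF_pretangent 2) VF_T vf_add vf_addN.

Lemma vf_lP (A : VF_cat) :
  vf_fld (VF_T A) ;; fmap T (l (vf_car A))
  = l (vf_car A) ;; vf_fld (VF_T (VF_T A)).
Proof.
rewrite /= fmapM !seqmA -l_nat -!seqmA -(ta_lcc (tc_axioms X)).
by rewrite -!seqmA.
Qed.

Definition vf_l (A : VF_cat) : VF_T A ~> VF_T (VF_T A) :=
  @VFHom (VF_T A) (VF_T (VF_T A)) (l (vf_car A)) (vf_lP A).

Lemma vf_lN (A B : VF_cat) (f : A ~> B) :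
  fmap VF_T f ;; vf_l B = vf_l A ;; fmap (functor_comp VF_T VF_T) f.
Proof. by apply: U_inj; apply: l_nat. Qed.

Definition VF_l : nattrans VF_T (functor_comp VF_T VF_T) :=
  @NatTrans _ _ VF_T (functor_comp VF_T VF_T) vf_l vf_lN.

Lemma vf_cP (A : VF_cat) :
  vf_fld (VF_T (VF_T A)) ;; fmap T (c (vf_car A))
  = c (vf_car A) ;; vf_fld (VF_T (VF_T A)).
Proof.
rewrite /= fmapM !seqmA -c_nat -!seqmA; congr (_ ;; _).
by rewrite !seqmA (ta_ccc (tc_axioms X)).
Qed.

Definition vf_c (A : VF_cat) : VF_T (VF_T A) ~> VF_T (VF_T A) :=
  @VFHom (VF_T (VF_T A)) (VF_T (VF_T A)) (c (vf_car A)) (vf_cP A).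

Lemma vf_cN (A B : VF_cat) (f : A ~> B) :
  fmap (functor_comp VF_T VF_T) f ;; vf_c B
  = vf_c A ;; fmap (functor_comp VF_T VF_T) f.
Proof. by apply: U_inj; apply: c_nat. Qed.

Definition VF_c : nattrans (functor_comp VF_T VF_T) (functor_comp VF_T VF_T) :=
  @NatTrans _ _ (functor_comp VF_T VF_T) (functor_comp VF_T VF_T) vf_c vf_cN.

Definition VF_data : tangent_data VF_cat :=
  @TangentData VF_cat VF_pretangent VF_0 VF_add VF_l VF_c.

Lemma U_pair (A Y : VF_cat) (x y : Y ~> VF_T A)
    (H : x ;; VF_p A = y ;; VF_p A)
    (H' : fmap U x ;; p (vf_car A) = fmap U y ;; p (vf_car A)) :
  fmap U (pair (VF_Tn 2 A) H) = pair (ptTn S 2 (vf_car A)) H'.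
Proof.
apply: (@pair_uniq X _ _ _ (ptTn S 2 (vf_car A)) _ _ _ H').
  exact: (congr1 (fmap U) (pair_pr0 (VF_Tn 2 A) H)).
exact: (congr1 (fmap U) (pair_pr1 (VF_Tn 2 A) H)).
Qed.

Lemma U_Tpair (A Y : VF_cat) (x y : Y ~> VF_T (VF_T A))
    (H : x ;; fmap VF_T (VF_p A) = y ;; fmap VF_T (VF_p A))
    (H' : fmap U x ;; fmap T (p (vf_car A))
        = fmap U y ;; fmap T (p (vf_car A))) :
  fmap U (pair (ptTTn VF_pretangent 2 A) H)
  = pair (ptTTn S 2 (vf_car A)) H'.
Proof.
apply: (@pair_uniq X _ _ _ (ptTTn S 2 (vf_car A)) _ _ _ H').
  exact: (congr1 (fmap U) (pair_pr0 (ptTTn VF_pretangent 2 A) H)).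
exact: (congr1 (fmap U) (pair_pr1 (ptTTn VF_pretangent 2 A) H)).
Qed.

Lemma VF_axioms : tangent_axioms VF_data.
Proof.
have ax := tc_axioms X.
split.
- move=> A; have ab := ta_add ax (vf_car A); split.
  + by apply: U_inj; apply: (ab_add_over ab).
  + by apply: U_inj; apply: (ab_zero_over ab).
  + move=> H; apply: U_inj; have H' := congr1 (fmap U) H.
    by rewrite fmapM (U_pair H H'); apply: (ab_comm ab).
  + move=> H; apply: U_inj; have H' := congr1 (fmap U) H.
    by rewrite fmapM (U_pair H H'); apply: (ab_unit ab).
  + move=> x y w Hxy Hyz Hxy_z Hx_yz; apply: U_inj.
    have Hxy' := congr1 (fmap U) Hxy; have Hyz' := congr1 (fmap U) Hyz.
    have H1' := congr1 (fmap U) Hxy_z; have H2' := congr1 (fmap U) Hx_yz.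
    have E1 : fmap U (pair (ptTn VF_data 2 A) Hxy ;; tdadd VF_data A)
        = pair (ptTn S 2 (vf_car A)) Hxy' ;; add (vf_car A).
      by rewrite fmapM (U_pair Hxy Hxy').
    have E2 : fmap U (pair (ptTn VF_data 2 A) Hyz ;; tdadd VF_data A)
        = pair (ptTn S 2 (vf_car A)) Hyz' ;; add (vf_car A).
      by rewrite fmapM (U_pair Hyz Hyz').
    rewrite [LHS]fmapM [RHS]fmapM (U_pair Hxy_z H1') (U_pair Hx_yz H2').
    change (fmap U (pair (ptTn VF_data 2 A) Hxy ;; tdadd VF_data A)
      ;; p (vf_car A) = fmap U w ;; p (vf_car A)) in H1'.
    change (fmap U x ;; p (vf_car A)
      = fmap U (pair (ptTn VF_data 2 A) Hyz ;; tdadd VF_data A)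
        ;; p (vf_car A)) in H2'.
    move: H1' H2'; rewrite E1 E2.
    exact: (ab_assoc ab).
- move=> A; have m := ta_l ax (vf_car A); split.
  + by apply: U_inj; apply: (abm_square m).
  + move=> H; apply: U_inj; have H' := congr1 (fmap U) H.
    by rewrite [RHS]fmapM (U_Tpair H H'); apply: (abm_add m).
  + by apply: U_inj; apply: (abm_zero m).
- move=> A; have m := ta_c ax (vf_car A); split.
  + by apply: U_inj; apply: (abm_square m).
  + move=> H; apply: U_inj; have H' := congr1 (fmap U) H.
    by rewrite [RHS]fmapM (U_pair (A := VF_T A) H H'); apply: (abm_add m).
  + by apply: U_inj; apply: (abm_zero m).
- by move=> A; apply: U_inj; apply: (ta_cc ax).
- by move=> A; apply: U_inj; apply: (ta_lc ax).
- by move=> A; apply: U_inj; apply: (ta_ll ax).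
- by move=> A; apply: U_inj; apply: (ta_ccc ax).
- by move=> A; apply: U_inj; apply: (ta_lcc ax).
- move=> A H; apply: VF_pullback => k; have H' := congr1 (fmap U) H.
  have -> : fmap U (vlift H) = @vlift X S (vf_car A) H'.
    by rewrite /vlift fmapM (U_Tpair H H').
  exact: (ta_vlift ax).
Qed.

Definition VF : tangent_category := TangentCategory VF_axioms.

End VF.

(* Main.v *)
Require Import Defs.
From mathcomp Require Import all_boot.
From mathcomp Require Import boolp.

Set Implicit Arguments.
Unset Strict Implicit.
Unset Printing Implicit Defensive.

(** A map [Y : M ~> T M] underlies a map [(M, V) ~> T (M, V)] of [VF X] exactly
    when [V ;; T Y = Y ;; T V ;; c].  Since [c] is an involution, composing
    with [c] on the right turns this into [V ;; T Y ;; c = Y ;; T V], which is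
    the commutation of [V] and [Y].  The section condition [Y ;; p = 1] is the
    same in both categories, as the forgetful functor [VF X -> X] is faithful
    and carries the projection to the projection.  Hence the forgetful functor
    restricts to a bijection between the vector fields on [(M, V)] and the
    vector fields on [M] that commute with [V]. *)

(** Both directions of the equivalence cancel one copy of [c]. *)
Lemma vf_commute_morphismP (X : tangent_category) (M : X)
    (V Y : M ~> tcT X M) :
  V ;; fmap (tcT X) Y = Y ;; (fmap (tcT X) V ;; tcc X M) <-> vf_commute V Y.
Proof.
split=> E.
  by rewrite /vf_commute E -!seqmA (ta_cc (tc_axioms X)) seqm1.
by rewrite seqmA -E -!seqmA (ta_cc (tc_axioms X)) seqm1.
Qed.

Section FieldsOnVFObject.
Variables (X : tangent_category) (A : VF X).
Local Notation U := (VF_forget X).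
Local Notation T := (tcT X).

Lemma VF_map_commute (Y : A ~> tcT (VF X) A) : vf_commute (vf_fld A) (vf_map Y).
Proof. exact/vf_commute_morphismP/(vf_mapP Y). Qed.

Lemma VF_vector_fieldP (Y : A ~> tcT (VF X) A) :
  is_vector_field Y <-> is_vector_field (fmap U Y : vf_car A ~> T (vf_car A)).
Proof.
by split=> [E | E]; [apply: (congr1 (fmap U) E) | apply: U_inj; apply: E].
Qed.

(** The map [A ~> T A] of [VF X] carried by a map of [X] that commutes with the
    vector field of [A]; it is not required to be a section of [p]. *)
Definition VF_of_commute (Y : vf_car A ~> T (vf_car A))
    (H : vf_commute (vf_fld A) Y) : A ~> tcT (VF X) A :=
  @VFHom X A (tcT (VF X) A) Y ((vf_commute_morphismP (vf_fld A) Y).2 H).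

(** The forgetful functor, restricted to the vector fields on [A]. *)
Definition commuting_field (Y : {Y : A ~> tcT (VF X) A | is_vector_field Y}) :
    {Y : vf_car A ~> T (vf_car A) |
      is_vector_field Y /\ vf_commute (vf_fld A) Y} :=
  exist _ (fmap U (sval Y))
    (conj ((VF_vector_fieldP (sval Y)).1 (svalP Y)) (VF_map_commute (sval Y))).

(** The inverse of [commuting_field]. *)
Definition field_of_commuting
    (Y : {Y : vf_car A ~> T (vf_car A) |
           is_vector_field Y /\ vf_commute (vf_fld A) Y}) :
    {Y : A ~> tcT (VF X) A | is_vector_field Y} :=
  exist _ (VF_of_commute (svalP Y).2)
    ((VF_vector_fieldP (VF_of_commute (svalP Y).2)).2 (svalP Y).1).

Lemma commuting_field_bij : bijective commuting_field.
Proof.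
exists field_of_commuting => -[Y HY]; apply: eq_exist => //=.
exact: U_inj.
Qed.

End FieldsOnVFObject.

Theorem proposition2p18 (X : tangent_category) (M : X) (V : M ~> tcT X M)
    (hV : is_vector_field V) :
  let A : VF X := VFObj hV in
  let U : functor (VF X) X := VF_forget X in
  (forall Y : M ~> tcT X M, is_vector_field Y ->
     (exists Y' : A ~> tcT (VF X) A, fmap U Y' = Y /\ is_vector_field Y')
     <-> vf_commute V Y)
  /\
  (forall Y' : A ~> tcT (VF X) A,
     is_vector_field Y' -> is_vector_field (fmap U Y' : M ~> tcT X M))
  /\
  (exists phi : {Y' : A ~> tcT (VF X) A | is_vector_field Y'} ->
                {Y : M ~> tcT X M | is_vector_field Y /\ vf_commute V Y},
     bijective phi /\ forall Y', sval (phi Y') = fmap U (sval Y')).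
Proof.
move=> A U; split; last split.
- move=> Y hY; split=> [[Y' [<- _]] | H]; first exact: (VF_map_commute Y').
  exists (@VF_of_commute X A Y H); split=> //.
  exact/VF_vector_fieldP.
- by move=> Y' /VF_vector_fieldP.
- by exists (@commuting_field X A); split; first exact: (@commuting_field_bij X A).
Qed.
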